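(* Let $X\subset\mathbb{R}$ be the set of irrational real numbers that are not noble. Then $\mathbf J_{\mathbb R}$ maps $X$ to $X$, and for all $x\in X$: (FE:0) $\mathbf J_{\mathbb R}(\mathbf J_{\mathbb R}(x))=x$; (FE:I) $\mathbf J_{\mathbb R}(1/x)=1/\mathbf J_{\mathbb R}(x)$; (FE:II) $\mathbf J_{\mathbb R}(-x)=-1/\mathbf J_{\mathbb R}(x)$; (FE:III) $\mathbf J_{\mathbb R}(1-x)=1-\mathbf J_{\mathbb R}(x)$; (FE:IV) $\mathbf J_{\mathbb R}(1+x)=1+1/\mathbf J_{\mathbb R}(x)$; and, for every $M\in \mathrm{PGL}_2(\mathbb Z)$, (FE:V) $\mathbf J_{\mathbb R}(M(\mathbf J_{\mathbb R}(x)))=(\mathbf J M)(x)$; (FE:VI) $\mathbf J_{\mathbb R}(Mx)=(\mathbf J M)(\mathbf J_{\mathbb R}(x))$.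
   Context: Write $\widehat{\mathbb R}=\mathbb R\cup\{\infty\}$. $\mathrm{PGL}_2(\mathbb Z)$ is the group of integral $2\times2$ matrices of determinant $\pm1$ modulo $\pm I$, acting on $\widehat{\mathbb R}$ by Möbius maps $x\mapsto (ax+b)/(cx+d)$. It is generated by $K:x\mapsto 1-x$, $U:x\mapsto 1/x$, $V:x\mapsto -x$, with presentation $\langle V,U,K\mid V^2=U^2=K^2=(VU)^2=(KU)^3=1\rangle$. Dyer's outer automorphism $\mathbf J$ of $\mathrm{PGL}_2(\mathbb Z)$ is the automorphism with $V\mapsto UV$, $U\mapsto U$, $K\mapsto K$. Definition of $\mathbf J_{\mathbb R}$. An infinite binary string $a\in\{0,1\}^\omega$ is written $a=0^{n_0}1^{n_1}0^{n_2}1^{n_3}\cdots$ with $n_0\ge 0$ and $n_i\ge 1$ for $i\ge1$; if $a$ is eventually constant the list of exponents is finite and its last entry is $\infty$. Put $\kappa(a)=[n_0,n_1,n_2,\dots]=n_0+\cfrac1{n_1+\cfrac1{n_2+\cdots}}\in[0,\infty]$, with $1/\infty=0$ and $[\infty]=\infty$ (so $[n_0,\dots,n_k,\infty]=[n_0,\dots,n_k]$). This is a bijection from not-eventually-constant strings to positive irrationals. Let $\phi=(01)^\omega=0101\dots$, $\phi^*=(10)^\omega=1010\dots$, and let $\oplus$ be term-wise exclusive or. The map $\mathbf J_{\mathbb R}:\mathbb R\setminus\mathbb Q\to\widehat{\mathbb R}$ is defined as follows: if $x>0$ is irrational and $x=\kappa(a)$, then $\mathbf J_{\mathbb R}(x)=\kappa(a\oplus\phi)$;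 if $x<0$ is irrational and $-1/x=\kappa(a)$, then $\mathbf J_{\mathbb R}(x)=-1/\kappa(a\oplus\phi^* )$ (with $1/0=\infty$, $1/\infty=0$). Noble numbers are the elements of the $\mathrm{PGL}_2(\mathbb Z)$-orbit of the golden section $\Phi=(1+\sqrt5)/2$. *)

(* Defs.v *)
From HB Require Import structures.
From mathcomp Require Import all_boot all_order all_algebra.
From mathcomp Require Import generic_quotient.
From mathcomp Require Import all_classical all_reals all_analysis.
Set Implicit Arguments.
Unset Strict Implicit.
Unset Printing Implicit Defensive.
Import Order.TTheory GRing.Theory Num.Theory.
Import numFieldNormedType.Exports.
Local Open Scope classical_set_scope.
Local Open Scope quotient_scope.
Local Open Scope ring_scope.

Definition det_pm1 : pred 'M[int]_2 :=
  fun M => (\det M == 1) || (\det M == -1).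

Record GL2Z := MkGL2Z { GL2Z_val :> 'M[int]_2; GL2Z_detP : det_pm1 GL2Z_val }.

HB.instance Definition _ := [isSub for GL2Z_val].
HB.instance Definition _ := [Choice of GL2Z by <:].

Lemma det_pm1_unit (M : 'M[int]_2) : det_pm1 M -> M \in unitmx.
Proof. by rewrite unitmxE /det_pm1 => /orP[] /eqP->. Qed.

Lemma det_pm1_1 : det_pm1 1%:M.
Proof. by rewrite /det_pm1 det1. Qed.

Lemma det_pm1_mul (M N : GL2Z) : det_pm1 (GL2Z_val M *m GL2Z_val N).
Proof.
by case: M N => [M +] [N +]; rewrite /det_pm1 /= det_mulmx;
   do 2![case/orP=> /eqP->].
Qed.

Lemma det_pm1_inv (M : GL2Z) : det_pm1 (invmx (GL2Z_val M)).
Proof. by case: M => [M +]; rewrite /det_pm1 /= det_inv; case/orP=> /eqP->. Qed.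

Lemma GL2Z_unit (M : GL2Z) : GL2Z_val M \in unitmx.
Proof. exact/det_pm1_unit/GL2Z_detP. Qed.

Definition GL2Z_one := MkGL2Z det_pm1_1.
Definition GL2Z_mul (M N : GL2Z) := MkGL2Z (det_pm1_mul M N).
Definition GL2Z_inv (M : GL2Z) := MkGL2Z (det_pm1_inv M).

Fact GL2Z_mulA : associative GL2Z_mul.
Proof. by move=> M N P; apply: val_inj; rewrite /= mulmxA. Qed.
Fact GL2Z_mul1g : left_id GL2Z_one GL2Z_mul.
Proof. by move=> M; apply: val_inj; rewrite /= mul1mx. Qed.
Fact GL2Z_mulg1 : right_id GL2Z_one GL2Z_mul.
Proof. by move=> M; apply: val_inj; rewrite /= mulmx1. Qed.
Fact GL2Z_mulVg : left_inverse GL2Z_one GL2Z_inv GL2Z_mul.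
Proof. by move=> M; apply: val_inj; rewrite /= mulVmx // GL2Z_unit. Qed.
Fact GL2Z_mulgV : right_inverse GL2Z_one GL2Z_inv GL2Z_mul.
Proof. by move=> M; apply: val_inj; rewrite /= mulmxV // GL2Z_unit. Qed.

HB.instance Definition _ := isGroup.Build GL2Z
  GL2Z_mulA GL2Z_mul1g GL2Z_mulg1 GL2Z_mulVg GL2Z_mulgV.

Definition eq_pm : rel GL2Z :=
  fun M N => (GL2Z_val M == GL2Z_val N) || (GL2Z_val M == - GL2Z_val N).

Fact eq_pm_refl : reflexive eq_pm.
Proof. by move=> M; rewrite /eq_pm eqxx. Qed.
Fact eq_pm_sym : symmetric eq_pm.
Proof.
by move=> M N; rewrite /eq_pm eq_sym; congr orb; rewrite eq_sym eqr_oppLR.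
Qed.
Fact eq_pm_trans : transitive eq_pm.
Proof.
move=> N M P; rewrite /eq_pm => /orP[] /eqP-> /orP[] /eqP->;
by rewrite ?opprK ?eqxx ?orbT.
Qed.

Canonical eq_pm_equiv := EquivRel eq_pm eq_pm_refl eq_pm_sym eq_pm_trans.

Definition PGL2Z := {eq_quot eq_pm}.
HB.instance Definition _ := Choice.on PGL2Z.
HB.instance Definition _ := EqQuotient.on PGL2Z.

Definition toPGL (M : GL2Z) : PGL2Z := \pi_PGL2Z M.

Lemma toPGLP (M N : GL2Z) : reflect (toPGL M = toPGL N) (eq_pm M N).
Proof. by apply: (iffP idP) => [|/eqP]; [move=> h; apply/eqmodP|rewrite eqmodE]. Qed.

Lemma eq_pm_repr (M : GL2Z) : eq_pm (repr (toPGL M)) M.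
Proof. by apply/toPGLP; rewrite /toPGL reprK. Qed.

Definition PGL2Z_one : PGL2Z := toPGL 1%g.
Definition PGL2Z_mul (g h : PGL2Z) : PGL2Z := toPGL (repr g * repr h)%g.
Definition PGL2Z_inv (g : PGL2Z) : PGL2Z := toPGL (repr g)^-1%g.

Lemma eq_pm_mul (M M' N N' : GL2Z) :
  eq_pm M M' -> eq_pm N N' -> eq_pm (M * N)%g (M' * N')%g.
Proof.
rewrite /eq_pm /= => /orP[] /eqP-> /orP[] /eqP->;
by rewrite ?mulmxN ?mulNmx ?opprK ?eqxx ?orbT.
Qed.

Lemma toPGLM (M N : GL2Z) : toPGL (M * N)%g = PGL2Z_mul (toPGL M) (toPGL N).
Proof. by apply/toPGLP; rewrite eq_pm_sym eq_pm_mul ?eq_pm_repr. Qed.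

Lemma toPGLV (M : GL2Z) : toPGL M^-1%g = PGL2Z_inv (toPGL M).
Proof.
apply/toPGLP; set N := repr (toPGL M).
have h : eq_pm (M^-1 * N * N^-1)%g (M^-1 * M * N^-1)%g.
  by rewrite !eq_pm_mul ?eq_pm_refl ?eq_pm_repr.
by move: h; rewrite mulgK mulVg mul1g.
Qed.

Lemma toPGL_surj (g : PGL2Z) : exists M, g = toPGL M.
Proof. by exists (repr g); rewrite /toPGL reprK. Qed.

Fact PGL2Z_mulA : associative PGL2Z_mul.
Proof.
move=> g h k; have [M ->] := toPGL_surj g; have [N ->] := toPGL_surj h.
by have [P ->] := toPGL_surj k; rewrite -!toPGLM mulgA.
Qed.
Fact PGL2Z_mul1g : left_id PGL2Z_one PGL2Z_mul.
Proof. by move=> g; have [M ->] := toPGL_surj g; rewrite -toPGLM mul1g. Qed.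
Fact PGL2Z_mulg1 : right_id PGL2Z_one PGL2Z_mul.
Proof. by move=> g; have [M ->] := toPGL_surj g; rewrite -toPGLM mulg1. Qed.
Fact PGL2Z_mulVg : left_inverse PGL2Z_one PGL2Z_inv PGL2Z_mul.
Proof. by move=> g; have [M ->] := toPGL_surj g; rewrite -toPGLV -toPGLM mulVg. Qed.
Fact PGL2Z_mulgV : right_inverse PGL2Z_one PGL2Z_inv PGL2Z_mul.
Proof. by move=> g; have [M ->] := toPGL_surj g; rewrite -toPGLV -toPGLM mulgV. Qed.

HB.instance Definition _ := isGroup.Build PGL2Z
  PGL2Z_mulA PGL2Z_mul1g PGL2Z_mulg1 PGL2Z_mulVg PGL2Z_mulgV.

Definition mx22 (a b c d : int) : 'M[int]_2 :=
  \matrix_(i < 2, j < 2) nth 0 (nth [::] [:: [:: a; b]; [:: c; d]] i) j.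

Lemma det_mx22 a b c d : \det (mx22 a b c d) = a * d - b * c.
Proof.
rewrite (expand_det_row _ 0) big_ord_recl big_ord1 /cofactor !det_mx11 !mxE /=.
by rewrite expr0 expr1 mul1r mulN1r mulrN.
Qed.

Fact det_pm1_V : det_pm1 (mx22 (-1) 0 0 1).
Proof. by rewrite /det_pm1 det_mx22. Qed.
Fact det_pm1_U : det_pm1 (mx22 0 1 1 0).
Proof. by rewrite /det_pm1 det_mx22. Qed.
Fact det_pm1_K : det_pm1 (mx22 (-1) 1 0 1).
Proof. by rewrite /det_pm1 det_mx22. Qed.

Definition PGL_V : PGL2Z := toPGL (MkGL2Z det_pm1_V).
Definition PGL_U : PGL2Z := toPGL (MkGL2Z det_pm1_U).
Definition PGL_K : PGL2Z := toPGL (MkGL2Z det_pm1_K).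

Definition is_dyer (J : PGL2Z -> PGL2Z) : Prop :=
  [/\ bijective J, {morph J : g h / (g * h)%g},
      J PGL_V = (PGL_U * PGL_V)%g, J PGL_U = PGL_U & J PGL_K = PGL_K].

(* Definite description: V, U and K generate the group, so at most one map
   satisfies [is_dyer], and by Dyer's theorem one does; the default [id] is
   never used. *)
Definition dyer : PGL2Z -> PGL2Z :=
  @xget (PGL2Z -> PGL2Z : choiceType) id is_dyer.

Notation hat R := (option R).
Notation infty := None (only parsing).

Section HatR.
Variable R : realType.

Definition hat_opp : hat R -> hat R := omap (fun t => - t).
Definition hat_add (r : R) : hat R -> hat R := omap (fun t => r + t).
Definition hat_inv (y : hat R) : hat R :=
  if y is Some t then (if t == 0 then infty else Some t^-1) else Some 0.

Definition moebius_mx (M : 'M[int]_2) (y : hat R) : hat R :=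
  let a : R := (M 0 0)%:~R in let b : R := (M 0 1)%:~R in
  let c : R := (M 1 0)%:~R in let d : R := (M 1 1)%:~R in
  match y with
  | Some t => if c * t + d == 0 then infty else Some ((a * t + b) / (c * t + d))
  | None => if c == 0 then infty else Some (a / c)
  end.

Definition moebius (g : PGL2Z) : hat R -> hat R :=
  moebius_mx (GL2Z_val (repr g)).

Lemma moebius_mxN M : moebius_mx (- M) =1 moebius_mx M.
Proof.
move=> [t|]; rewrite /moebius_mx !mxE !intrN.
  by rewrite !mulNr -!opprD oppr_eq0; case: ifP => // _; rewrite invrN mulrNN.
by rewrite oppr_eq0; case: ifP => // _; rewrite invrN mulrNN.
Qed.

Lemma moebius_toPGL (M : GL2Z) : moebius (toPGL M) =1 moebius_mx (GL2Z_val M).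
Proof.
move=> y; rewrite /moebius; have := eq_pm_repr M.
by rewrite /eq_pm => /orP[] /eqP-> //; rewrite moebius_mxN.
Qed.

Definition golden : R := (1 + Num.sqrt 5) / 2.

Definition noble : set R :=
  [set x | exists g : PGL2Z, moebius g (Some golden) = Some x].

Definition nonnoble_irrational : set R := @irrational R `\` noble.

Definition bitstring := nat -> bool.

(* Length of the longest prefix of [a] made of the letter [b];
   [None] stands for an infinite run. *)
Definition run_length (b : bool) (a : bitstring) : option nat :=
  if pselect (exists n, a n != b) is left h then Some (ex_minn h) else None.

(* The exponents n_i of a = b^{n_0} (~~b)^{n_1} b^{n_2} ...; past an infinite
   exponent all later entries are set to [None] as well. *)
Fixpoint exponent_from (b : bool) (a : bitstring) (i : nat) : option nat :=
  match run_length b a, i with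
  | Some n, i'.+1 => exponent_from (~~ b) (fun j => a (n + j)%N) i'
  | r, _ => r
  end.

Definition exponent : bitstring -> nat -> option nat := exponent_from false.

(* [cfrac k e] is [e_0, ..., e_{k-1}] = [e_0, ..., e_{k-1}, oo]. *)
Fixpoint cfrac (k : nat) (e : nat -> option nat) : hat R :=
  if k is k'.+1 then
    if e 0%N is Some n then
      hat_add n%:R (hat_inv (cfrac k' (fun i => e i.+1)))
    else infty
  else infty.

(* If some exponent is infinite, the value is the finite continued fraction on
   the exponents preceding it. Otherwise it is the limit of the convergents
   [e_0, ..., e_k], all of which are finite, so that [odflt 0] only strips
   the constructor [Some]. *)
Definition kappa (a : bitstring) : hat R :=
  let e := exponent a in
  if pselect (exists k, e k == None) is left h then cfrac (ex_minn h) e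
  else Some (limn (fun k => odflt 0 (cfrac k.+1 e))).

(* A string with value [x]; it is unique when [x] is a positive irrational. *)
Definition kappa_inv (x : R) : bitstring :=
  xget (fun=> false) [set a | kappa a = Some x].

Definition xor_string (a b : bitstring) : bitstring := fun n => a n (+) b n.

Definition phi : bitstring := odd.
Definition phi_star : bitstring := fun n => ~~ odd n.

(* Only the values at irrational reals are meaningful; the map is totalised by
   [infty] elsewhere so that it can be composed. *)
Definition jimm (y : hat R) : hat R :=
  if y is Some x then
    if `[< irrational x >] then
      if 0 < x then kappa (xor_string (kappa_inv x) phi)
      else hat_opp (hat_inv (kappa (xor_string (kappa_inv (- x^-1)) phi_star)))
    else infty
  else infty.

End HatR.

(* Main.v *)
Require Import Defs.
From HB Require Import structures.
From mathcomp Require Import all_boot all_order all_algebra.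
From mathcomp Require Import ring lra zify.
From mathcomp Require Import all_classical all_reals all_analysis.
Import Order.TTheory GRing.Theory Num.Theory.
Import numFieldNormedType.Exports.
Local Open Scope classical_set_scope.
Local Open Scope ring_scope.

(** The map [jimm] is an involution of the set X of irrational non-noble
    numbers, so that conjugation by it is an automorphism of the permutation
    group of X; everything else is the observation that this automorphism
    preserves the group of Moebius maps and acts on generators as Dyer's
    automorphism does.

    Strings.  For an irrational x > 0 let [code x] be the itinerary of x under
    the Farey map, which sends x to x - 1 (letter 0) if x > 1 and to x / (1 - x)
    (letter 1) if x < 1.  Reading a prefix of a string as a path in the
    Stern-Brocot tree gives a matrix of determinant 1 and hence an interval;
    unless the string is eventually constant the intervals shrink to a single
    irrational point.  The convergents defining [kappa a] are eventually in each
    of these intervals ([convergent_in_sb]), so [kappa] and [code] are inverse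
    bijections between the strings that are not eventually constant and the
    positive irrationals ([kappa_code], [code_kappa]).  In these terms
    code (1 + x) is 0 followed by code x, and code (1 / x) is the negation of
    code x.

    Functional equations.  The strings that are not eventually constant and
    not eventually alternating form a set that is stable under exclusive or
    with 0101...; the corresponding numbers are called [generic] here.  On
    positive generic numbers [jimm] acts on codes by this exclusive or, so the
    equations for 1 / x, for 1 + x and the involution property are identities
    between strings; the equation for - x holds by definition, and the one for
    1 - x follows by splitting the line at 0 and 1 ([jimmR1B]).

    Generic is the same as irrational and not noble ([generic_nonnoble]): the
    code of the golden section is 0101..., an eventually alternating code is
    removed one letter at a time by Moebius maps, and conversely the generic
    numbers are stable under the group while the golden section is not generic.

    Dyer's automorphism.  Every integral matrix of determinant 1 or - 1 is
    reduced to the identity by U, V, K through Euclid's algorithm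
    ([PGL2Z_ind]).  By the functional equations the conjugate by [jimm] of each
    generator is again a Moebius map, namely U, UV, K for U, V, K; hence so is
    the conjugate of every group element, and the Moebius map is unique because
    the action on generic numbers is faithful.  This yields an automorphism
    with the prescribed values on the generators ([dyerP]) without using a
    presentation of the group, and the equations for an arbitrary group element
    say that [dyer] is this conjugation. *)

(** * Binary strings *)

Definition bcons (i : bool) (a : bitstring) : bitstring :=
  fun n => if n is n'.+1 then a n' else i.
Definition btail (a : bitstring) : bitstring := fun n => a n.+1.
Definition bneg (a : bitstring) : bitstring := fun n => ~~ a n.

Lemma bcons_btail a : bcons (a 0%N) (btail a) = a.
Proof. by apply/funext => -[]. Qed.

Lemma bnegK : involutive bneg.
Proof. by move=> a; apply/funext => n; rewrite /bneg negbK. Qed.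

Lemma bneg_bcons i a : bneg (bcons i a) = bcons (~~ i) (bneg a).
Proof. by apply/funext => -[]. Qed.

(** With c = false the string is eventually constant, with c = true it is
    eventually alternating; a single predicate serves for both because exclusive
    or with [phi] swaps them. *)
Definition tail_step (c : bool) (a : bitstring) : Prop :=
  exists N, forall n, (N <= n)%N -> a n.+1 = c (+) a n.

Lemma tail_step_bcons c i a : tail_step c (bcons i a) <-> tail_step c a.
Proof.
split=> -[N h]; first by exists N => n Nn; exact: (h n.+1 (leqW Nn)).
by exists N.+1 => -[|n]//; exact: h.
Qed.

Lemma tail_step_bneg c a : tail_step c (bneg a) <-> tail_step c a.
Proof.
by split=> -[N h]; exists N => n /h; rewrite /bneg => e;
   [apply: negb_inj; rewrite e|rewrite e]; rewrite addbN.
Qed.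

Lemma tail_step_phi c a : tail_step c (xor_string a phi) <-> tail_step (~~ c) a.
Proof.
split=> -[N h]; exists N => n /h; rewrite /xor_string /phi /=;
  by case: c {h}; case: (a n) (a n.+1) (odd n) => [] [] [].
Qed.

Lemma xor_phiK a : xor_string (xor_string a phi) phi = a.
Proof. by apply/funext => n; rewrite /xor_string addbK. Qed.

Lemma xor_bneg_phi a : xor_string (bneg a) phi = bneg (xor_string a phi).
Proof. by apply/funext => n; rewrite /xor_string /bneg addNb. Qed.

Lemma xor_bneg_phi_star a : xor_string (bneg a) phi_star = xor_string a phi.
Proof. by apply/funext => n; rewrite /xor_string /bneg /phi_star addNb addbN negbK. Qed.

Lemma xor_bcons_phi i a :
  xor_string (bcons i a) phi = bcons i (bneg (xor_string a phi)).
Proof.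
by apply/funext => -[|n]; rewrite /xor_string /bneg /phi /= ?addbF ?addbN.
Qed.

(** The matrix with rows (a, b) and (c, d), read as the interval from b / d to
    a / c: it is the image of [0, oo] under the Moebius map of the matrix. *)
Record frame := Frame { fa : nat; fb : nat; fc : nat; fd : nat }.

(** Right multiplication by the matrix of x + 1 (letter 0) or of x / (x + 1)
    (letter 1); [stepl] is left multiplication by the same matrix. *)
Definition stepr (i : bool) (M : frame) : frame :=
  let: Frame a b c d := M in
  if i then Frame (a + b) b (c + d) d else Frame a (a + b) c (c + d).
Definition stepl (i : bool) (M : frame) : frame :=
  let: Frame a b c d := M in
  if i then Frame a b (a + c) (b + d) else Frame (a + c) (b + d) c d.
(** Conjugation by the map 1 / x, which exchanges the two letters. *)
Definition swap (M : frame) : frame :=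
  let: Frame a b c d := M in Frame d c b a.

(** The node of the Stern-Brocot tree reached by the first n letters of a. *)
Fixpoint sb (n : nat) (a : bitstring) : frame :=
  if n is n'.+1 then stepr (a n') (sb n' a) else Frame 1 0 0 1.

(** The product of the letter matrices can be built from either end: growth
    and nesting are visible from the right, self-similarity from the left. *)
Lemma sbSl n a : sb n.+1 a = stepl (a 0%N) (sb n (btail a)).
Proof.
elim: n => [|n IH]; first by rewrite /=; case: (a 0%N).
rewrite [LHS]/= -/(sb n.+1 a) IH /=.
case: (sb n _) => p q r s; rewrite /btail.
by case: (a 0%N) (a n.+1) => [] []; congr Frame; lia.
Qed.

Lemma sb_bneg n a : sb n (bneg a) = swap (sb n a).
Proof.
elim: n => //= n ->; case: (sb n a) => p q r s; rewrite /bneg.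
by case: (a n); congr Frame => //=; rewrite addnC.
Qed.

Lemma sb_det n a : (fa (sb n a) * fd (sb n a) = (fb (sb n a) * fc (sb n a)).+1)%N.
Proof. by elim: n => //= n; case: (sb n a) => p q r s /=; case: (a n) => /=; nia. Qed.

Lemma sb_mono m n a : (m <= n)%N ->
  (fc (sb m a) <= fc (sb n a))%N && (fd (sb m a) <= fd (sb n a))%N.
Proof.
move=> /subnK <-; elim: (n - m)%N => [|k]; first by rewrite add0n !leqnn.
rewrite addSn /=; case: (sb (k + m) a) => p q r s /=.
by case: (a _) => /=; lia.
Qed.

Lemma nonconst_letter a N i : ~ tail_step false a ->
  exists2 n, (N <= n)%N & a n = i.
Proof.
move=> nc; apply: contrapT => h; apply: nc; exists N => n Nn /=.
have e m : (N <= m)%N -> a m = ~~ i.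
  move=> Nm; case: (eqVneq (a m) i) => [ami|]; first by case: h; exists m.
  by case: (a m) (i) => [] [].
by rewrite !e // leqW.
Qed.

(** The letter 1 adds d to c and the letter 0 adds c to d, so reading one
    further occurrence of each increases both denominators. *)
Lemma sb_growth a B : ~ tail_step false a ->
  exists n, (B <= fc (sb n a))%N && (B <= fd (sb n a))%N.
Proof.
move=> nc; elim: B => [|B [n /andP[Bc Bd]]]; first by exists 0%N.
have [k nk ak] := nonconst_letter _ n true nc.
have [l kl al] := nonconst_letter _ k.+1 false nc.
exists l.+1.
have /andP[c1 d1] := sb_mono _ _ a nk.
have /andP[c2 d2] := sb_mono _ _ a kl.
have := sb_det k a; move: c1 d1 c2 d2 => /=; rewrite ak al.
by case: (sb l a) (sb k a) => p q r s [p' q' r' s'] /=; nia.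
Qed.

Section Values.
Context {R : realType}.
Implicit Types (x y : R) (a : bitstring).

(** Membership in the closed interval of a frame, with denominators cleared so
    that it makes sense for degenerate frames and at infinity, which belongs to
    the interval exactly when its upper end a / c is 1 / 0. *)
Definition in_frame (M : frame) (y : hat R) : bool :=
  if y is Some x then
    ((fb M)%:R <= (fd M)%:R * x) && ((fc M)%:R * x <= (fa M)%:R)
  else fc M == 0%N.

Lemma in_frame_ge0 M x : (0 < fd M)%N -> in_frame M (Some x) -> 0 <= x.
Proof.
move=> d0 /andP[h _]; move: (le_trans (ler0n _ _) h).
by rewrite pmulr_rge0 ?ltr0n.
Qed.

Lemma sb_fd_gt0 n a : (0 < fd (sb n a))%N.
Proof. by have := sb_det n a; case: (fd _) => //; rewrite muln0. Qed.

Lemma in_frame_swap M (y : hat R) : (0 < fd M)%N ->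
  in_frame M y -> in_frame (swap M) (hat_inv y).
Proof.
case: M y => p q r s [x|] /=; last by move=> _ /eqP->; rewrite !mulr0 lexx ler0n.
case: (eqVneq x 0) => [->|x0] /= s0.
  by rewrite !mulr0 => /andP[]; rewrite lern0.
move=> h; have xp : 0 < x.
  by rewrite lt_def x0 (in_frame_ge0 (Frame p q r s)).
by rewrite ler_pdivlMr // ler_pdivrMr // andbC.
Qed.

Lemma in_frame_stepl0 M (y : hat R) :
  in_frame M y -> in_frame (stepl false M) (hat_add 1 y).
Proof.
case: M y => p q r s [x|] //= /andP[h1 h2]; rewrite !natrD.
by apply/andP; split; lra.
Qed.

(** For a string that is not eventually constant this is the graph of [kappa];
    in this form it involves no limit and can be followed letter by letter. *)
Definition value a x := forall n, in_frame (sb n a) (Some x).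

Lemma value_ge0 a x : value a x -> 0 <= x.
Proof. by move=> /(_ 0%N); apply: in_frame_ge0. Qed.

(** The interval of a frame of determinant 1 has length 1 / (c d). *)
Lemma in_frame_dist M x y : (fa M * fd M = (fb M * fc M).+1)%N ->
  in_frame M (Some x) -> in_frame M (Some y) ->
  (fc M)%:R * (fd M)%:R * `|x - y| <= 1.
Proof.
case: M => p q r s /= e.
wlog xy : x y / y <= x => [hw hx hy|].
  by case: (leP y x) => [/hw|/ltW /hw]; [|rewrite distrC]; apply.
have -> : `|x - y| = x - y by rewrite ger0_norm ?subr_ge0.
have e' : p%:R * s%:R = q%:R * r%:R + 1 :> R by rewrite -!natrM e -natr1.
move=> /andP[_ h1] /andP[h2 _].
have := ler_wpM2l (ler0n R s) h1; have := ler_wpM2l (ler0n R r) h2.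
lra.
Qed.

Lemma value_unique a x y : ~ tail_step false a -> value a x -> value a y -> x = y.
Proof.
move=> nc vx vy; apply/eqP; rewrite -subr_eq0 -normr_le0 leNgt; apply/negP => e0.
have [B Be] : exists B : nat, `|x - y|^-1 < B%:R.
  by exists (Num.trunc `|x - y|^-1).+1; rewrite truncnS_gt.
have [n /andP[nc1 nd1]] := sb_growth _ B.+1 nc.
have := in_frame_dist _ _ _ (sb_det n a) (vx n) (vy n); rewrite leNgt => /negP; apply.
have B1 : 1 <= (fd (sb n a))%:R :> R by rewrite ler1n (leq_trans _ nd1).
have B2 : B%:R <= (fc (sb n a))%:R :> R by rewrite ler_nat ltnW.
have : 1 < B%:R * `|x - y| by rewrite -ltr_pdivrMr // div1r.
move=> /lt_le_trans; apply; rewrite ler_pM2r //.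
by apply: le_trans B2 _; rewrite ler_peMr // ler0n.
Qed.

(** A fraction u / v in the interval of a frame is a combination of the columns
    (a, c) and (b, d) with natural coefficients, not both zero; its denominator v
    is then at least c or at least d, and these are unbounded along the
    string. *)
Lemma value_irrational a x : ~ tail_step false a -> value a x -> irrational x.
Proof.
move=> nc vx /rationalP[u [v xE]].
(* For v = 0 the quotient u / v is 0 by convention, but the lower ends of the
   intervals become positive. *)
have v0 : (0 < v)%N.
  case: v xE => // x0; have [n /andP[c1 d1]] :=
    sb_growth (bneg a) 1 ltac:(by move/tail_step_bneg).
  have /andP[+ _] := vx n; rewrite x0 invr0 !mulr0 lern0.
  by move: c1; rewrite sb_bneg; case: (sb n a) => p q r s /=; case: q.
have v0R : (0 : R) < v%:R by rewrite ltr0n.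
have [n /andP[c1 d1]] := sb_growth a v.+1 nc.
have /andP[h1 h2] := vx n; move: h1 h2 (sb_det n a) c1 d1; rewrite xE.
case: (sb n a) => p q r s /=; rewrite !mulrA ler_pdivlMr // ler_pdivrMr //.
rewrite !pmulrn -!intrM !ler_int => h1 h2 e c1 d1.
(* The coefficients of the column vector (u, v) on the columns of the frame. *)
have ev : v%:Z = s%:Z * (p%:Z * v%:Z - r%:Z * u) + r%:Z * (s%:Z * u - q%:Z * v%:Z).
  have e' : p%:Z * s%:Z = q%:Z * r%:Z + 1 by lia.
  by ring: e'.
have a0 : 0 <= p%:Z * v%:Z - r%:Z * u by rewrite subr_ge0.
have b0 : 0 <= s%:Z * u - q%:Z * v%:Z by rewrite subr_ge0.
move: ev a0 b0; set al := (_ - r%:Z * u); set be := (_ - q%:Z * _).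
move=> ev a0 b0.
case: (eqVneq al 0) => [al0|al0].
  case: (eqVneq be 0) => [be0|be0]; first by move: ev; rewrite al0 be0; lia.
  have : r%:Z <= r%:Z * be by rewrite ler_peMr //; lia.
  by move: ev; rewrite al0; lia.
have : s%:Z <= s%:Z * al by rewrite ler_peMr //; lia.
have : 0 <= r%:Z * be by rewrite mulr_ge0.
lia.
Qed.

End Values.

(** * Exponents and convergents *)

(** Characterizes [run_length], whose definition through [ex_minn] does not
    compute. *)
Lemma run_lengthP b a (r : option nat) :
  (if r is Some n then a n != b /\ forall m, (m < n)%N -> a m = b
   else forall m, a m = b) -> run_length b a = r.
Proof.
rewrite /run_length; case: pselect => [h|h]; last first.
  case: r => // n [an _]; case: h; by exists n.
case: r => [n [an lt]|all_b]; last by exfalso; case: h => n; rewrite all_b eqxx.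
case: ex_minnP => m am minm; congr Some; apply/eqP; rewrite eqn_leq minm //=.
by rewrite leqNgt; apply/negP => /lt e; rewrite e eqxx in am.
Qed.

Lemma run_length_spec b a :
  if run_length b a is Some n then a n != b /\ forall m, (m < n)%N -> a m = b
   else forall m, a m = b.
Proof.
rewrite /run_length; case: pselect => [h|h].
  case: ex_minnP => m am minm; split=> // k km; apply/eqP; apply: contraTT km.
  by rewrite -leqNgt; apply: minm.
by move=> m; apply/eqP; apply: contra_notT h => h; exists m.
Qed.

Lemma run_length_bcons b a :
  run_length b (bcons b a) = omap succn (run_length b a).
Proof.
apply: run_lengthP; have := run_length_spec b a; case: run_length => [n [an lt]|h] /=.
  by split=> // -[|m] //=; apply: lt.
by case.
Qed.

Lemma run_length_bneg b a : run_length b (bneg a) = run_length (~~ b) a.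
Proof.
apply: run_lengthP; have := run_length_spec (~~ b) a; case: run_length => [n [an lt]|h].
  split=> [|m /lt]; rewrite /bneg; last by move->; rewrite negbK.
  by move: an; case: (a n) b {lt} => [] [].
by move=> m; rewrite /bneg h negbK.
Qed.

Lemma exponent_fromS b a i :
  exponent_from b a i.+1 =
  if run_length b a is Some n then exponent_from (~~ b) (fun j => a (n + j)%N) i
  else None.
Proof. by rewrite /=; case: run_length. Qed.

Lemma exponent_from0 b a : exponent_from b a 0 = run_length b a.
Proof. by rewrite /=; case: run_length. Qed.

Lemma exponent_from_bcons b a i :
  exponent_from b (bcons b a) i =
  if i is 0%N then omap succn (exponent_from b a 0) else exponent_from b a i.
Proof.
case: i => [|i]; first by rewrite !exponent_from0 run_length_bcons.
by rewrite !exponent_fromS run_length_bcons; case: run_length.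
Qed.

(** When the first letter is not the expected one, the first run is empty and
    the remaining exponents are those read with the other letter expected. *)
Lemma exponent_from_other b a i : a 0%N != b ->
  exponent_from b a i = if i is i'.+1 then exponent_from (~~ b) a i' else Some 0%N.
Proof.
move=> ab; have r0 : run_length b a = Some 0%N by apply: run_lengthP.
by case: i => [|i]; [rewrite exponent_from0 r0|rewrite exponent_fromS r0].
Qed.

Lemma exponent_from_bneg b a i : exponent_from b (bneg a) i = exponent_from (~~ b) a i.
Proof.
elim: i a b => [|i IH] a b; first by rewrite !exponent_from0 run_length_bneg.
rewrite !exponent_fromS run_length_bneg; case: run_length => // n.
exact: (IH (fun j => a (n + j)%N)).
Qed.

Lemma exponent_None_tail_const b a i :
  exponent_from b a i = None -> tail_step false a.
Proof.
elim: i a b => [|i IH] a b.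
  rewrite exponent_from0; have := run_length_spec b a; case: run_length => // h _.
  by exists 0%N => n _; rewrite /= !h.
rewrite exponent_fromS; have := run_length_spec b a; case: run_length => [n _ /IH|h _].
  move=> [N h]; exists (N + n)%N => m Nm.
  have := h (m - n)%N ltac:(lia) => /=.
  have -> : (n + (m - n).+1 = m.+1)%N by lia.
  by have -> : (n + (m - n) = m)%N by lia.
by exists 0%N => n _; rewrite /= !h.
Qed.

Lemma tail_const_exponent_None b a :
  tail_step false a -> exists i, exponent_from b a i = None.
Proof.
case=> N; elim: N a b => [|N IH] a b h.
  have {}h n : a n = a 0%N by elim: n => // n <-; rewrite h.
  case: (eqVneq (a 0%N) b) => [e|ne].
    by exists 0%N; rewrite exponent_from0; apply: run_lengthP => m; rewrite h.
  exists 1%N; rewrite exponent_from_other // exponent_from0; apply: run_lengthP => m.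
  by rewrite h; move: ne; case: (a 0%N) b => [] [].
have [i ei] := IH (btail a) b (fun n Nn => h n.+1 Nn).
have [j ej] := IH (btail a) (~~ b) (fun n Nn => h n.+1 Nn).
rewrite -(bcons_btail a).
move: (a 0%N) => c.
case: (eqVneq c b) => [->|ne].
  by exists i; rewrite exponent_from_bcons; case: i ei => [|i] ->.
exists j.+1; rewrite exponent_from_other //.
have -> : c = ~~ b by move: ne; case: (c) (b) => [] [].
by rewrite exponent_from_bcons; case: j ej => // ->.
Qed.

Section Convergence.
Context {R : realType}.
Implicit Types (x y : R) (a : bitstring).

(** For k = 0 this is infinity, and [convergent k.+1 a] is the value of the
    continued fraction on the first k + 1 exponents when these are finite. *)
Definition convergent (k : nat) a : hat R := cfrac R k (exponent a).

Lemma convergent_bcons0 k a :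
  convergent k.+1 (bcons false a) = hat_add 1 (convergent k.+1 a).
Proof.
rewrite /convergent /exponent /= run_length_bcons.
case: run_length => //= n; case: (hat_inv _) => //= x.
by rewrite -natr1 -addrA [n%:R + _]addrC -addrA [x + _]addrC addrA.
Qed.

Lemma cfracS k (e : nat -> option nat) :
  cfrac R k.+1 e =
  if e 0%N is Some n then hat_add n%:R (hat_inv (cfrac R k (fun i => e i.+1)))
  else None.
Proof. by []. Qed.

(** A string starting with 1 has exponents 0, n_1, n_2, ... and its negation
    has exponents n_1, n_2, ...; the number of terms drops by one, which is
    why statements on convergents below hold only from some index on. *)
Lemma convergent_bneg k a : a 0%N = true ->
  convergent k.+1 a = hat_inv (convergent k (bneg a)).
Proof.
move=> a0; rewrite /convergent /exponent cfracS exponent_from_other ?a0 //.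
have -> : (fun i => exponent_from false a i.+1) = exponent_from false (bneg a).
  by apply/funext => i; rewrite exponent_from_other ?a0 // exponent_from_bneg.
by case: (hat_inv _) => //= x; rewrite add0r.
Qed.

Lemma convergent_ge0 k a : in_frame (sb 0 a) (convergent k a).
Proof.
rewrite /convergent; elim: k (exponent a) => // k IH e; rewrite cfracS.
case: (e 0%N) => [n|//]; move: (IH (fun i => e i.+1)).
case: (cfrac _ _ _) => [x|] /=; last by rewrite mul1r mul0r addr0 !ler0n.
rewrite mul1r mul0r ler01 andbT => x0.
case: (eqVneq x 0) => //= _.
by rewrite mul1r mul0r ler01 andbT addr_ge0 // invr_ge0.
Qed.

(** Prepending 0 translates both the convergents and the intervals by one, and
    negating the string inverts both; so the claim propagates from a shorter
    prefix, the letter 1 being reduced to the letter 0 by a negation. *)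
Lemma convergent_in_sb n a :
  exists K, forall k, (K <= k)%N -> in_frame (sb n a) (convergent k a).
Proof.
elim: n a => [|n IH] a; first by exists 0%N => k _; apply: convergent_ge0.
have step0 b : exists K, forall k, (K <= k)%N ->
    in_frame (sb n.+1 (bcons false b)) (convergent k (bcons false b)).
  have [K h] := IH b; exists K.+1 => -[//|k] Kk.
  rewrite convergent_bcons0 sbSl; apply: in_frame_stepl0; exact: h (ltnW _).
rewrite -(bcons_btail a); case: (a 0%N) => //.
have [K h] := step0 (bneg (btail a)).
exists K.+1 => -[//|k] Kk.
rewrite convergent_bneg // -[bcons true _]bnegK sb_bneg bnegK.
rewrite bneg_bcons.
by apply: in_frame_swap; [apply: sb_fd_gt0|apply: h].
Qed.

(** The convergents are trapped in intervals whose lengths tend to zero. *)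
Lemma convergents_cvg a : ~ tail_step false a ->
  exists x, value a x /\
    (fun k => odflt 0 (convergent k.+1 a)) @ \oo --> x.
Proof.
move=> nc; pose u k : R := odflt 0 (convergent k.+1 a).
have u_in n : exists K, forall k, (K <= k)%N -> in_frame (sb n a) (Some (u k)).
  have [m /andP[c1 _]] := sb_growth a 1 nc.
  have [K h] := convergent_in_sb n a; have [K' h'] := convergent_in_sb m a.
  exists (maxn K K') => k; rewrite geq_max => /andP[Kk Kk'].
  move: (h _ (leqW Kk)) (h' _ (leqW Kk')); rewrite /u; case: convergent => //= _ /eqP m0.
  by rewrite m0 in c1.
have u_cvg : cvgn u.
  apply/cauchy_cvgP/cauchy_exP => e e0.
  have [B Be] : exists B : nat, e^-1 < B%:R.
    by exists (Num.trunc e^-1).+1; rewrite truncnS_gt.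
  have [n /andP[nc1 nd1]] := sb_growth a B.+1 nc.
  have [K h] := u_in n.
  exists (u K); exists K => // k /= Kk.
  rewrite /ball /= ltNge; apply/negP => ek.
  have := in_frame_dist _ _ _ (sb_det n a) (h K (leqnn K)) (h k Kk).
  rewrite leNgt => /negP; apply.
  have B1 : 1 <= (fd (sb n a))%:R :> R by rewrite ler1n (leq_trans _ nd1).
  have B2 : B%:R <= (fc (sb n a))%:R :> R by rewrite ler_nat ltnW.
  have : 1 < B%:R * e by rewrite -ltr_pdivrMr // div1r.
  move=> /lt_le_trans; apply.
  apply: ler_pM => //; first exact: ltW.
  by apply: le_trans B2 _; rewrite ler_peMr // ler0n.
have vx : value a (limn u).
  move=> n; have [K h] := u_in n; apply/andP; split.
    have -> : (fd (sb n a))%:R * limn u = limn (fun k => (fd (sb n a))%:R * u k).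
      by apply/esym/cvg_lim => //; apply: cvgMl_tmp.
    apply: limr_ge; first by apply: is_cvgMl_tmp.
    by exists K => // k /= /h /andP[].
  have -> : (fc (sb n a))%:R * limn u = limn (fun k => (fc (sb n a))%:R * u k).
    by apply/esym/cvg_lim => //; apply: cvgMl_tmp.
  apply: limr_le; first by apply: is_cvgMl_tmp.
  by exists K => // k /= /h /andP[].
by exists (limn u); split.
Qed.

Lemma kappa_value a x : ~ tail_step false a -> value a x -> kappa R a = Some x.
Proof.
move=> nc vx; rewrite /kappa; case: pselect => [h|_].
  by exfalso; case: h => k /eqP /exponent_None_tail_const.
have [y [vy uy]] := convergents_cvg a nc.
congr Some; rewrite (value_unique _ _ _ nc vx vy).
exact: cvg_lim uy.
Qed.

Lemma value_kappa a : ~ tail_step false a -> exists2 x, value a x & kappa R a = Some x.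
Proof.
by move=> nc; have [x [vx _]] := convergents_cvg a nc; exists x => //; apply: kappa_value.
Qed.

(** With [kappa_irrational_nonconst] this excludes eventually constant strings
    from the candidates in the definition of [kappa_inv]. *)
Lemma cfrac_rational k e x : cfrac R k e = Some x -> rational x.
Proof.
elim: k e x => // k IH e x; rewrite cfracS; case: (e 0%N) => // n.
case ec : cfrac => [y|] /=; last by move=> [<-]; exists n%:R => //; rewrite ratr_nat addr0.
case: eqP => //= _ [<-]; have [q _ <-] := IH _ _ ec.
by exists (n%:R + q^-1) => //; rewrite rmorphD /= fmorphV ratr_nat.
Qed.

Lemma kappa_irrational_nonconst a x : kappa R a = Some x -> irrational x -> ~ tail_step false a.
Proof.
move=> + irr /(tail_const_exponent_None false) [i ei]; rewrite /kappa.
case: pselect => [h /cfrac_rational //|[]].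
by exists i; apply/eqP.
Qed.

End Convergence.

(** * The code of a positive irrational *)

Section Irrational.
Context {R : realType}.
Implicit Types (x y : R).

Lemma irrationalN x : irrational x -> irrational (- x).
Proof.
move=> irr [q _ e]; apply: irr; exists (- q) => //.
by rewrite rmorphN /= e opprK.
Qed.

Lemma irrationalV x : irrational x -> irrational x^-1.
Proof.
by move=> irr [q _ e]; apply: irr; exists q^-1 => //; rewrite fmorphV /= e invrK.
Qed.

Lemma irrationalD1 x : irrational x -> irrational (1 + x).
Proof.
move=> irr [q _ e]; apply: irr; exists (q - 1) => //.
by rewrite rmorphB rmorph1 /= e addrC addKr.
Qed.

Lemma irrational1B x : irrational x -> irrational (1 - x).
Proof. by move=> /irrationalN /irrationalD1. Qed.

Lemma irrational_neq_nat x n : irrational x -> x != n%:R.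
Proof. by move=> irr; apply/eqP => e; apply: irr; exists n%:R; rewrite ?ratr_nat. Qed.

Lemma irrational_neq0 x : irrational x -> x != 0.
Proof. exact: irrational_neq_nat 0%N. Qed.

Lemma irrational_neq1 x : irrational x -> x != 1.
Proof. exact: irrational_neq_nat 1%N. Qed.

End Irrational.

Section Code.
Context {R : realType}.
Implicit Types (x y : R) (a : bitstring).

(** Removes the first letter of the code: it inverts x + 1 on [1, oo) and
    x / (x + 1) on [0, 1). *)
Definition farey x : R := if x < 1 then x / (1 - x) else x - 1.
Definition code x : bitstring := fun n => iter n farey x < 1.

Lemma code_unfold x : code x = bcons (x < 1) (code (farey x)).
Proof. by apply/funext => -[|n] //=; rewrite /code iterSr. Qed.

Lemma farey_irrational x : irrational x -> irrational (farey x).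
Proof.
move=> irr; rewrite /farey; case: ifP => _; last first.
  by rewrite -[x - 1]opprB; apply/irrationalN/irrational1B.
have x1 : 1 - x != 0 by apply/irrational_neq0/irrational1B.
have -> : x / (1 - x) = - (1 - (1 - x)^-1) by field.
exact/irrationalN/irrational1B/irrationalV/irrational1B.
Qed.

Lemma farey_gt0 x : irrational x -> 0 < x -> 0 < farey x.
Proof.
move=> irr x0; rewrite /farey; case: (ltP x 1) => x1; first by rewrite divr_gt0 ?subr_gt0.
by rewrite subr_gt0 lt_def x1 irrational_neq1.
Qed.

Lemma fareyV x : irrational x -> 0 < x -> farey x^-1 = (farey x)^-1.
Proof.
move=> irr x0; have xn0 := irrational_neq0 _ irr.
rewrite /farey invf_lt1 //; case: (ltgtP x 1) => [x1|x1|e].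
- by rewrite invf_div; field.
- by field; rewrite subr_eq0 gt_eqF.
- by have := irrational_neq1 _ irr; rewrite e eqxx.
Qed.

Lemma codeV x : irrational x -> 0 < x -> code x^-1 = bneg (code x).
Proof.
move=> irr x0; apply/funext => n; rewrite /code /bneg.
elim: n x irr x0 => [|n IH] x irr x0.
  rewrite /= invf_lt1 // -leNgt le_eqVlt eq_sym.
  by rewrite (negbTE (irrational_neq1 _ irr)).
by rewrite !iterSr fareyV // IH //; [apply: farey_irrational|apply: farey_gt0].
Qed.

Lemma code1D x : 0 < x -> code (1 + x) = bcons false (code x).
Proof.
move=> x0; rewrite code_unfold /farey ltNge lerDl ltW //=.
by rewrite addrC addKr.
Qed.

(** The first letter of the path is undone by the Farey map. *)
Lemma in_frame_farey M x : irrational x -> 0 < x ->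
  in_frame (stepl (x < 1) M) (Some x) = in_frame M (Some (farey x)).
Proof.
move=> irr x0; case: M => p q r s; rewrite /farey; case: (ltP x 1) => x1 /=; rewrite !natrD.
  rewrite !mulrA ler_pdivlMr ?subr_gt0 // ler_pdivrMr ?subr_gt0 //.
  by apply/idP/idP => /andP[h1 h2]; apply/andP; split; lra.
by apply/idP/idP => /andP[h1 h2]; apply/andP; split; lra.
Qed.

Lemma value_code x : irrational x -> 0 < x -> value (code x) x.
Proof.
move=> + + n; elim: n x => [|n IH] x irr x0.
  by rewrite /= mul1r mul0r ler01 ltW.
rewrite sbSl -[code x 0%N]/(x < 1) in_frame_farey //.
have -> : btail (code x) = code (farey x) by rewrite [code x]code_unfold.
by apply: IH; [apply: farey_irrational|apply: farey_gt0].
Qed.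

Lemma value_head a x : irrational x -> value a x -> a 0%N = (x < 1).
Proof.
move=> irr /(_ 1%N); have x1 := irrational_neq1 _ irr; rewrite /=.
case: (a 0%N) => /=; rewrite !add0n ?addn0 !mul1r ?mul0r => /andP[].
  by rewrite [x <= 1]le_eqVlt (negbTE x1) => _ /= ->.
by rewrite leNgt => /negbTE ->.
Qed.

(** The intervals determine the letters: 1 separates the two intervals of
    depth one, and x is not 1. *)
Lemma code_value a x : irrational x -> value a x -> a = code x.
Proof.
move=> irr v; apply/funext => n; rewrite /code.
elim: n a x irr v => [|n IH] a x irr v; first exact: value_head.
rewrite iterSr -(IH (btail a)) //; first exact: farey_irrational.
have x0 : 0 < x by rewrite lt_def irrational_neq0 ?(value_ge0 _ _ v).
by move=> m; rewrite -in_frame_farey // -(value_head _ _ irr v) -sbSl.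
Qed.

(** An orbit that stays above 1 is an arithmetic progression of step - 1. *)
Lemma iter_farey_ge1 x n : irrational x ->
  (forall k, 1 <= iter k farey x) -> n%:R < x.
Proof.
elim: n x => [|n IH] x irr h; first by apply: lt_le_trans ltr01 (h 0%N).
rewrite -natr1 -ltrBrDr.
have -> : x - 1 = farey x by rewrite /farey ltNge (h 0%N).
by apply: IH => [|k]; [apply: farey_irrational|rewrite -iterSr].
Qed.

(** By the symmetry x -> 1 / x only an orbit staying above 1 has to be
    excluded, which the archimedean property does. *)
Lemma code_nonconst x : irrational x -> 0 < x -> ~ tail_step false (code x).
Proof.
move=> irr x0 [N h].
have iter_ok n : irrational (iter n farey x) /\ 0 < iter n farey x.
  by elim: n => //= n [i p]; split; [apply: farey_irrational|apply: farey_gt0].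
have [yirr y0] := iter_ok N; set y := iter N farey x in yirr y0.
have cy k : code y k = code y 0%N.
  by elim: k => // k <-; have := h (k + N)%N (leq_addl _ _); rewrite /code -addSn !iterD.
wlog y1 : y yirr y0 cy / 1 <= y.
  case: (leP 1 y) => y1 hw; first exact: (hw y).
  apply: (hw y^-1); first exact: irrationalV.
  - by rewrite invr_gt0.
  - by move=> k; rewrite codeV // /bneg cy.
  - by rewrite invf_ge1 // ltW.
have yk k : 1 <= iter k farey y by rewrite leNgt -[_ < 1]/(code y k) cy /code /= -leNgt.
have := iter_farey_ge1 y (Num.trunc y).+1 yirr yk.
by apply/negP; rewrite -leNgt ltW // truncnS_gt.
Qed.

Lemma kappa_code x : irrational x -> 0 < x -> kappa R (code x) = Some x.
Proof.
by move=> irr x0; apply: kappa_value; [apply: code_nonconst|apply: value_code].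
Qed.

(** The string defining [kappa_inv] is thereby unique. *)
Lemma code_kappa a x : irrational x -> kappa R a = Some x -> a = code x.
Proof.
move=> irr e; have nc := kappa_irrational_nonconst _ _ e irr.
have [y vy] := value_kappa (R := R) _ nc; rewrite e => -[xy].
by apply: code_value => //; rewrite xy.
Qed.

Lemma kappa_invE x : irrational x -> 0 < x -> kappa_inv x = code x.
Proof.
move=> irr x0; rewrite /kappa_inv; apply: xget_unique; first exact: kappa_code.
by move=> a; apply: code_kappa.
Qed.

Lemma kappa_nonconst a : ~ tail_step false a ->
  exists y, [/\ kappa R a = Some y, irrational y, 0 < y & code y = a].
Proof.
move=> nc; have [y vy e] := value_kappa (R := R) _ nc.
have irr := value_irrational _ _ nc vy.
exists y; split => //; last exact/esym/code_value.
by rewrite lt_def irrational_neq0 ?(value_ge0 _ _ vy).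
Qed.

End Code.

(** * Functional equations on generic numbers *)

Section Jimm.
Context {R : realType}.
Implicit Types (x y z : R) (a : bitstring).

Lemma code_inj x y : irrational x -> irrational y -> 0 < x -> 0 < y ->
  code x = code y -> x = y.
Proof.
by move=> ix iy x0 y0 e; apply: Some_inj; rewrite -(kappa_code x) // e kappa_code.
Qed.

(** The code is taken of the absolute value because [jimm (- x)] is determined
    by [jimm x]. The code of an irrational is never eventually constant, so only
    alternation has to be excluded. *)
Definition generic x := irrational x /\ ~ tail_step true (code `|x|).

Lemma genericN x : generic x -> generic (- x).
Proof. by case=> irr nt; split; [apply: irrationalN|rewrite normrN]. Qed.

Lemma irrational_norm x : irrational x -> irrational `|x|.
Proof. by move=> irr; case: (ger0P x) => // _; apply: irrationalN. Qed.

Lemma genericV x : generic x -> generic x^-1.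
Proof.
case=> irr nt; split; first exact: irrationalV.
rewrite normfV codeV ?tail_step_bneg ?normr_gt0 ?irrational_neq0 //.
exact: irrational_norm.
Qed.

Lemma generic_pos x : irrational x -> 0 < x ->
  generic x <-> ~ tail_step true (code x).
Proof. by move=> irr x0; rewrite /generic gtr0_norm //; split=> [[]|]. Qed.

Lemma generic1D x : 0 < x -> generic (1 + x) <-> generic x.
Proof.
move=> x0; rewrite /generic !gtr0_norm ?addr_gt0 // code1D // tail_step_bcons.
split=> -[irr nt]; split=> //; last exact: irrationalD1.
by have -> : x = - (1 - (1 + x)) by [ring]; apply/irrationalN/irrational1B.
Qed.

(** The maps x and 1 - x on (0, 1), in terms of the Farey map: this is where
    x -> 1 - x is reduced to inversions and translations of positive numbers. *)
Lemma farey_lt1 x : 0 < x < 1 ->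
  [/\ 0 < farey x, x = (1 + (farey x)^-1)^-1 & 1 - x = (1 + farey x)^-1].
Proof.
move=> /andP[x0 x1]; have xn0 := lt0r_neq0 x0.
have x10 : 1 - x != 0 by rewrite subr_eq0 gt_eqF.
rewrite /farey x1; split; first by rewrite divr_gt0 ?subr_gt0.
  by field; rewrite x10 xn0 addrC subrK oner_eq0.
by field; rewrite x10 subrK oner_eq0.
Qed.

Lemma generic1B x : generic x -> generic (1 - x).
Proof.
move=> gx; have [irr _] := gx.
case: (ltgtP x 0) => [x0|x0|x0]; last by have := irrational_neq0 _ irr; rewrite x0 eqxx.
  by apply/generic1D; [rewrite oppr_gt0|apply: genericN].
case: (ltgtP x 1) => [x1|x1|x1]; last by have := irrational_neq1 _ irr; rewrite x1 eqxx.
  have [z0 xE ->] := farey_lt1 x ltac:(by rewrite x0).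
  apply/genericV/generic1D => //; rewrite -[farey x]invrK; apply: genericV.
  apply/generic1D; first by rewrite invr_gt0.
  by rewrite -[1 + _]invrK -xE; apply: genericV.
rewrite -opprB; apply: genericN; apply/generic1D; first by rewrite subr_gt0.
by rewrite addrC subrK.
Qed.

(** The default 0 is irrelevant on generic numbers, where [jimm] is
    finite. *)
Definition jimmR x : R := odflt 0 (jimm (Some x)).

(** Exclusive or with [phi] exchanges the eventually constant and the eventually
    alternating strings, the two kinds that a generic number excludes. *)
Lemma jimm_pos x : generic x -> 0 < x ->
  [/\ jimm (Some x) = Some (jimmR x), generic (jimmR x), 0 < jimmR x
    & code (jimmR x) = xor_string (code x) phi].
Proof.
move=> gx x0; have [irr nt] := gx; rewrite gtr0_norm // in nt.
have nc : ~ tail_step false (xor_string (code x) phi) by rewrite tail_step_phi.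
have [y [e iy y0 cy]] := kappa_nonconst (R := R) _ nc.
have jx : jimm (Some x) = Some y by rewrite /jimm asboolT // x0 kappa_invE.
rewrite /jimmR jx; split => //.
apply/generic_pos => //; rewrite cy tail_step_phi.
exact: code_nonconst.
Qed.

(** Negating the code turns [phi_star] into [phi], so the clause of [jimm] for
    negative numbers reduces to the one for positive numbers. *)
Lemma jimm_neg x : generic x -> 0 < x ->
  jimm (Some (- x)) = Some (- (jimmR x)^-1).
Proof.
move=> gx x0; have [irr _] := gx; have [jx _ y0 _] := jimm_pos _ gx x0.
rewrite /jimm asboolT ?oppr_gt0 ?ltNge ?(ltW x0) /=; last exact: irrationalN.
rewrite invrN opprK kappa_invE ?invr_gt0 //; last exact: irrationalV.
rewrite codeV // xor_bneg_phi_star.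
have -> : kappa R (xor_string (code x) phi) = Some (jimmR x).
  by rewrite -jx /jimm asboolT // x0 kappa_invE.
by rewrite /= gt_eqF.
Qed.

Lemma generic_ind (P : R -> Prop) :
  (forall x, generic x -> 0 < x -> P x) ->
  (forall x, generic x -> 0 < x -> P x -> P (- x)) ->
  forall x, generic x -> P x.
Proof.
move=> hp hn x gx; case: (ltgtP x 0) => [x0|x0|x0]; last 2 first.
- exact: hp.
- by case: gx => /irrational_neq0; rewrite x0 eqxx.
have gN := genericN _ gx; have N0 : 0 < - x by rewrite oppr_gt0.
by rewrite -[x]opprK; apply: hn => //; apply: hp.
Qed.

Lemma jimmE x : generic x -> jimm (Some x) = Some (jimmR x).
Proof.
move: x; apply: generic_ind => x gx x0; first by have [] := jimm_pos _ gx x0.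
by move=> _; rewrite /jimmR jimm_neg.
Qed.

Lemma jimmRN x : generic x -> jimmR (- x) = - (jimmR x)^-1.
Proof.
move: x; apply: generic_ind => x gx x0; first by rewrite /jimmR jimm_neg.
by move=> e; rewrite e opprK invrN invrK opprK.
Qed.

Lemma jimmR_generic x : generic x -> generic (jimmR x).
Proof.
move: x; apply: generic_ind => x gx x0; first by have [] := jimm_pos _ gx x0.
by move=> h; rewrite jimmRN //; apply/genericN/genericV.
Qed.

Lemma jimmRV x : generic x -> jimmR x^-1 = (jimmR x)^-1.
Proof.
move: x; apply: generic_ind => x gx x0; last first.
  by move=> e; rewrite invrN !jimmRN ?e ?invrN //; apply: genericV.
have [_ [iy _] y0 cy] := jimm_pos _ gx x0.
have xV : 0 < x^-1 by rewrite invr_gt0.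
have [_ [iz _] z0 cz] := jimm_pos _ (genericV _ gx) xV.
apply: code_inj; rewrite ?invr_gt0 //; first exact: irrationalV.
by rewrite cz !codeV ?cy ?xor_bneg_phi //; case: gx.
Qed.

Lemma jimmRK x : generic x -> jimmR (jimmR x) = x.
Proof.
move: x; apply: generic_ind => x gx x0; last first.
  by move=> e; rewrite jimmRN // jimmRN ?jimmRV ?e ?invrK //;
     [apply: jimmR_generic|apply/genericV/jimmR_generic].
have [_ gy y0 cy] := jimm_pos _ gx x0; have [_ [iz _] z0 cz] := jimm_pos _ gy y0.
by apply: code_inj => //; [case: gx|rewrite cz cy xor_phiK].
Qed.

(** Exclusive or with 0101... fixes the new first letter 0 and meets the rest
    of the string with 1010..., that is, it negates the shifted string. *)
Lemma jimmR1D x : generic x -> 0 < x -> jimmR (1 + x) = 1 + (jimmR x)^-1.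
Proof.
move=> gx x0; have [_ [iy _] y0 cy] := jimm_pos _ gx x0.
have x1 : 0 < 1 + x by rewrite addr_gt0.
have gx1 : generic (1 + x) by apply/generic1D.
have [_ [iz _] z0 cz] := jimm_pos _ gx1 x1.
have v0 : 0 < (jimmR x)^-1 by rewrite invr_gt0.
apply: code_inj; rewrite ?addr_gt0 //; first exact/irrationalD1/irrationalV.
by rewrite cz !code1D // codeV // cy xor_bcons_phi.
Qed.

(** For x < 0 or x > 1 one of x and 1 - x is - z and the other 1 + z;
    for x in (0, 1) they are inverses of 1 + 1 / z and 1 + z. In each
    case both sides become rational expressions in the image of z. *)
Lemma jimmR1B x : generic x -> jimmR (1 - x) = 1 - jimmR x.
Proof.
move=> gx; have [irr _] := gx.
case: (ltgtP x 0) => [x0|x0|x0]; last by have := irrational_neq0 _ irr; rewrite x0 eqxx.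
  by rewrite jimmR1D ?oppr_gt0 //; [rewrite jimmRN // invrN invrK|apply: genericN].
case: (ltgtP x 1) => [x1|x1|x1]; last by have := irrational_neq1 _ irr; rewrite x1 eqxx.
  have [z0 xE ->] := farey_lt1 x ltac:(by rewrite x0).
  set z := farey x in z0 xE *; have Vz0 : 0 < z^-1 by rewrite invr_gt0.
  have gz1 : generic (1 + z^-1) by rewrite -[1 + _]invrK -xE; apply: genericV.
  have gVz : generic z^-1 by apply/generic1D.
  have gz : generic z by rewrite -[z]invrK; apply: genericV.
  have [_ _ y0 _] := jimm_pos _ gz z0.
  rewrite xE !jimmRV //; last by apply/generic1D.
  rewrite !jimmR1D // jimmRV // invrK.
  by field; rewrite !gt_eqF // addr_gt0.
have z0 : 0 < x - 1 by rewrite subr_gt0.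
have gz : generic (x - 1) by apply/generic1D => //; rewrite addrC subrK.
have -> : jimmR x = 1 + (jimmR (x - 1))^-1 by rewrite -jimmR1D // addrC subrK.
by rewrite -opprB jimmRN //; ring.
Qed.

End Jimm.

(** * Generation of the modular group by U, V, K *)

Lemma mx22E (M : 'M[int]_2) : M = mx22 (M 0 0) (M 0 1) (M 1 0) (M 1 1).
Proof.
apply/matrixP => i j; rewrite mxE.
by case: i => -[|[|//]] hi; case: j => -[|[|//]] hj /=;
   congr (M _ _); apply: val_inj.
Qed.

Lemma mulmx22 a b c d a' b' c' d' :
  mx22 a b c d *m mx22 a' b' c' d' =
  mx22 (a * a' + b * c') (a * b' + b * d') (c * a' + d * c') (c * b' + d * d').
Proof.
apply/matrixP => i j; rewrite !mxE !big_ord_recl big_ord0 !mxE addr0.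
by case: i => -[|[|//]] hi; case: j => -[|[|//]] hj.
Qed.

Lemma mx22_1 : mx22 1 0 0 1 = 1%:M.
Proof. by rewrite (mx22E 1%:M) !mxE. Qed.

Lemma mx22N a b c d : - mx22 a b c d = mx22 (- a) (- b) (- c) (- d).
Proof. by rewrite (mx22E (- _)) !mxE. Qed.

Lemma det_pm1_mx22 a b c d :
  det_pm1 (mx22 a b c d) = (absz (a * d - b * c)%R == 1%N).
Proof. by rewrite /det_pm1 det_mx22; lia. Qed.

Lemma toPGL_mul (M N : GL2Z) : toPGL (M * N)%g = (toPGL M * toPGL N)%g.
Proof. exact: toPGLM. Qed.

(** Euclid's algorithm on the first column: K replaces the row (a, b) by
    (c - a, d - b), and V and U adjust signs and order. When c = 0 the diagonal
    entries are units and the same step reduces b. *)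
Lemma PGL2Z_ind (P : PGL2Z -> Prop) :
  P 1%g -> (forall g, P g -> P (PGL_U * g)%g) ->
  (forall g, P g -> P (PGL_V * g)%g) -> (forall g, P g -> P (PGL_K * g)%g) ->
  forall g, P g.
Proof.
move=> P1 PU PV PK.
(* Q is the claim for a matrix given by its entries; QU, QV and QK say that it
   may be verified after a row operation. *)
pose Q (a b c d : int) := forall M : GL2Z, GL2Z_val M = mx22 a b c d -> P (toPGL M).
have step (S : GL2Z) (a b c d : int) : (forall g, P g -> P (toPGL S * g)%g) ->
    GL2Z_val S *m GL2Z_val S = 1%:M ->
    (forall M, GL2Z_val M = GL2Z_val S *m mx22 a b c d -> P (toPGL M)) -> Q a b c d.
  move=> PS SS h M eM; have -> : M = (S * (S * M))%g.
    by apply: val_inj; rewrite /= mulmxA SS mul1mx.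
  by rewrite toPGL_mul; apply: PS; apply: h; rewrite /= eM.
have QU (a b c d : int) : Q c d a b -> Q a b c d.
  move=> q; apply: (step (MkGL2Z det_pm1_U) a b c d PU) => /=.
    by rewrite mulmx22 /= -mx22_1.
  by move=> M; rewrite mulmx22 !mul0r !mul1r !addr0 !add0r; apply: q.
have QV (a b c d : int) : Q (- a) (- b) c d -> Q a b c d.
  move=> q; apply: (step (MkGL2Z det_pm1_V) a b c d PV) => /=.
    by rewrite mulmx22 /= -mx22_1.
  by move=> M; rewrite mulmx22 !mul0r !mulN1r !mul1r !addr0 !add0r; apply: q.
have QK (a b c d : int) : Q (c - a) (d - b) c d -> Q a b c d.
  move=> q; apply: (step (MkGL2Z det_pm1_K) a b c d PK) => /=.
    by rewrite mulmx22 /= -mx22_1.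
  by move=> M; rewrite mulmx22 !mul0r !mulN1r !mul1r !add0r ![- _ + _]addrC; apply: q.
have Qpm : Q 1 0 0 1 /\ Q (-1) 0 0 (-1).
  split=> M eM; have -> : toPGL M = 1%g; rewrite ?P1 //; apply/toPGLP.
    by rewrite /eq_pm eM mx22_1 eqxx.
  by rewrite /eq_pm eM /= -mx22_1 mx22N oppr0 eqxx orbT.
have Q0 (a d : int) : `|a|%N = 1%N -> `|d|%N = 1%N -> Q a 0 0 d.
  move=> a1 d1; have [|] : a = d \/ a = - d by lia.
    by move->; have [->|->] : d = 1 \/ d = -1 by [lia]; case: Qpm.
  by move->; apply: QV; rewrite opprK oppr0;
     have [->|->] : d = 1 \/ d = -1 by [lia]; case: Qpm.
(* Upper triangular matrices: for b nonzero, one of d - b and d + b is closer to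
   0 than b, because d is a unit. *)
have Qtri n : forall a b d : int, `|a|%N = 1%N -> `|d|%N = 1%N -> (`|b| <= n)%N -> Q a b 0 d.
  elim: n => [|n IH] a b d a1 d1 bn.
    have -> : b = 0 by lia.
    exact: Q0.
  case: (eqVneq b 0) => [->|b0]; first exact: Q0.
  have [h|h] : absz (d - b)%R = `|b|.-1 \/ absz (d + b)%R = `|b|.-1 by lia.
    apply: QK; apply: IH; lia.
  by apply: QV; apply: QK; apply: IH; lia.
(* Euclid's algorithm on (a, c), measured by |a| + |c|. *)
have Qall n : forall a b c d : int, absz (a * d - b * c)%R = 1%N -> (`|a| + `|c| <= n)%N -> Q a b c d.
  elim: n => [|n IH] a b c d det1 acn.
    have [a0 c0] : a = 0 /\ c = 0 by lia.
    by move: det1; rewrite a0 c0 mul0r mulr0.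
  have tri : forall a b d : int, absz (a * d)%R = 1%N -> Q a b 0 d.
    move=> a' b' d'; rewrite abszM => /eqP; rewrite muln_eq1 => /andP[/eqP ? /eqP ?].
    exact: Qtri (leqnn _).
  case: (eqVneq c 0) => [c0|c0].
    by move: det1; rewrite c0 mulr0 subr0; apply: tri.
  case: (eqVneq a 0) => [a0|a0].
    apply: QU; rewrite a0; apply: tri.
    by move: det1; rewrite a0 mul0r sub0r abszN mulrC.
  have red (a' b' c' d' : int) : c' != 0 -> (`|c'| <= `|a'|)%N -> absz (a' * d' - b' * c')%R = 1%N ->
      (`|a'| + `|c'| <= n.+1)%N -> Q a' b' c' d'.
    move=> c0' ca det' le'.
    have [h|h] : (absz (c' - a')%R + `|c'| <= n)%N \/ (absz (c' + a')%R + `|c'| <= n)%N by lia.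
      by apply: QK; apply: IH => //; move: det'; rewrite !mulrBl; lia.
    apply: QV; apply: QK; apply: IH; rewrite !opprK //.
    by move: det'; rewrite !mulrDl; lia.
  case: (leqP `|c| `|a|) => [le|lt]; first exact: red.
  apply: QU; apply: red => //; [exact: ltnW| |by rewrite addnC].
  by rewrite -det1 -abszN opprB mulrC [c * b]mulrC.
move=> g; have [M ->] := toPGL_surj g.
apply: (Qall _ _ _ _ _ _ (leqnn _) M (mx22E M)).
have := GL2Z_detP M; rewrite [X in det_pm1 X](mx22E M) det_pm1_mx22.
by move/eqP.
Qed.

(** * The Moebius action and noble numbers *)

Section Action.
Context {R : realType}.
Implicit Types (x y z : R) (g h : PGL2Z).

Lemma irrational_affine x (c d : int) : irrational x -> (c != 0) || (d != 0) ->
  c%:~R * x + d%:~R != 0.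
Proof.
move=> irr cd; apply/eqP => e; case: (eqVneq c 0) => [c0|c0].
  by move: cd e; rewrite c0 eqxx mul0r add0r => /= d0 /eqP; rewrite intr_eq0 (negbTE d0).
apply: irr; exists ((- d)%:~R / c%:~R) => //.
have cR : c%:~R != 0 :> R by rewrite intr_eq0.
rewrite fmorph_div /= !ratr_int intrN; apply: (mulfI cR).
by rewrite mulrC divfK //; apply/eqP; rewrite eq_sym -addr_eq0 e.
Qed.

Lemma GL2Z_row_neq0 (M : GL2Z) : (GL2Z_val M 1 0 != 0) || (GL2Z_val M 1 1 != 0).
Proof.
have := GL2Z_detP M; rewrite [X in det_pm1 X](mx22E M) /det_pm1 det_mx22.
case: (eqVneq (GL2Z_val M 1 0) 0) => //= ->; case: (eqVneq (GL2Z_val M 1 1) 0) => //= ->.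
by rewrite !mulr0 subrr.
Qed.

Lemma moebius_irrational x (M : GL2Z) : irrational x ->
  moebius (toPGL M) (Some x) =
  Some (((GL2Z_val M 0 0)%:~R * x + (GL2Z_val M 0 1)%:~R)
        / ((GL2Z_val M 1 0)%:~R * x + (GL2Z_val M 1 1)%:~R)).
Proof.
move=> irr; rewrite moebius_toPGL /=.
by rewrite (negbTE (irrational_affine _ _ _ irr (GL2Z_row_neq0 M))).
Qed.

Lemma moebiusM g h x : irrational x ->
  moebius (g * h)%g (Some x) = moebius g (moebius h (Some x)).
Proof.
move=> irr; have [M ->] := toPGL_surj g; have [N ->] := toPGL_surj h.
rewrite -toPGL_mul (moebius_irrational x (M * N)%g irr) (moebius_irrational x N irr).
rewrite moebius_toPGL.
have den := irrational_affine _ _ _ irr (GL2Z_row_neq0 N).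
have := irrational_affine _ _ _ irr (GL2Z_row_neq0 (M * N)%g).
move: den; rewrite /= (mx22E M) (mx22E N) mulmx22 !mxE /= !intrD !intrM.
move: (M 0 0) (M 0 1) (M 1 0) (M 1 1) (N 0 0) (N 0 1) (N 1 0) (N 1 1).
move=> a b c d a' b' c' d' den prod.
have E : c%:~R * ((a'%:~R * x + b'%:~R) / (c'%:~R * x + d'%:~R)) + d%:~R =
  ((c%:~R * a'%:~R + d%:~R * c'%:~R) * x + (c%:~R * b'%:~R + d%:~R * d'%:~R))
    / (c'%:~R * x + d'%:~R) by field.
rewrite E mulf_eq0 invr_eq0 (negbTE den) (negbTE prod) /=.
by congr Some; field; rewrite den prod.
Qed.

Lemma moebius1 x : moebius 1%g (Some x) = Some x.
Proof.
apply: (etrans (moebius_toPGL (R := R) GL2Z_one (Some x))).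
rewrite /= !mxE /= mul0r add0r oner_eq0.
by rewrite mul1r addr0 divr1.
Qed.

Lemma moebiusU x : x != 0 -> moebius PGL_U (Some x) = Some x^-1.
Proof.
move=> x0; apply: (etrans (moebius_toPGL (R := R) (MkGL2Z det_pm1_U) (Some x))).
rewrite /= !mxE /= mul1r addr0 (negbTE x0).
by rewrite mul0r add0r div1r.
Qed.

Lemma moebiusV x : moebius PGL_V (Some x) = Some (- x).
Proof.
apply: (etrans (moebius_toPGL (R := R) (MkGL2Z det_pm1_V) (Some x))).
rewrite /= !mxE /= mul0r add0r oner_eq0.
by rewrite mulN1r addr0 divr1.
Qed.

Lemma moebiusK x : moebius PGL_K (Some x) = Some (1 - x).
Proof.
apply: (etrans (moebius_toPGL (R := R) (MkGL2Z det_pm1_K) (Some x))).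
rewrite /= !mxE /= mul0r add0r oner_eq0.
by rewrite mulN1r divr1 addrC.
Qed.

Lemma generic_moebius g x : generic x ->
  exists2 y, generic y & moebius g (Some x) = Some y.
Proof.
move=> gx; elim/PGL2Z_ind: g => [|g [y gy e]|g [y gy e]|g [y gy e]].
- by exists x; rewrite ?moebius1.
- exists y^-1; first exact: genericV.
  by rewrite moebiusM ?e ?moebiusU //; [apply/irrational_neq0; case: gy|case: gx].
- exists (- y); first exact: genericN.
  by rewrite moebiusM ?e ?moebiusV //; case: gx.
- exists (1 - y); first exact: generic1B.
  by rewrite moebiusM ?e ?moebiusK //; case: gx.
Qed.

Lemma phi_nonconst : ~ tail_step false phi.
Proof. by case=> N /(_ N (leqnn N)) /=; rewrite /phi /=; case: odd. Qed.

(** The string [phi] is 0 followed by its own negation, so its value y satisfies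
    y = 1 + 1 / y. *)
Lemma golden_code : [/\ irrational (golden R), 0 < golden R & code (golden R) = phi].
Proof.
have [y [_ iy y0 cy]] := kappa_nonconst (R := R) _ phi_nonconst.
suff <- : y = golden R by [].
have yE : y = 1 + y^-1.
  apply: code_inj => //; first exact/irrationalD1/irrationalV.
    by rewrite addr_gt0 // invr_gt0.
  rewrite code1D ?invr_gt0 // codeV // cy.
  by apply/funext => -[|n].
have yn0 := lt0r_neq0 y0.
have y1 : 1 < y by rewrite yE ltrDl invr_gt0.
have y2 : (2 * y - 1) ^+ 2 = 5.
  have : y * y = y * (1 + y^-1) by rewrite -yE.
  by rewrite mulrDr mulr1 divff // => h; ring: h.
rewrite /golden -y2 sqrtr_sqr ger0_norm; last by lra.
by field.
Qed.

Lemma noble_moebius g x y : noble x -> moebius g (Some x) = Some y -> noble y.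
Proof.
move=> [h hx] gx; exists (g * h)%g.
by rewrite moebiusM ?hx //; case: golden_code.
Qed.

Lemma nobleV x : x != 0 -> noble x -> noble x^-1.
Proof. by move=> x0 nx; apply: (noble_moebius PGL_U _ _ nx); rewrite moebiusU. Qed.

Lemma nobleN x : noble x -> noble (- x).
Proof. by move=> nx; apply: (noble_moebius PGL_V _ _ nx); rewrite moebiusV. Qed.

Lemma noble1D x : noble x -> noble (1 + x).
Proof.
by move=> /nobleN nx; apply: (noble_moebius PGL_K _ _ nx); rewrite moebiusK opprK.
Qed.

(** Removing the first letters of the code leads to the code of the golden
    section or of its inverse, and each letter is put back by a Moebius map. *)
Lemma alternating_noble x : irrational x -> 0 < x -> tail_step true (code x) -> noble x.
Proof.
move=> + + [N]; elim: N x => [|N IH] x irr x0 h.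
  have [ig g0 cg] := golden_code.
  have ng : noble (golden R) by exists 1%g; rewrite moebius1.
  have cx n : code x n = odd n (+) code x 0%N.
    by elim: n => // n IH; rewrite h // IH /= addNb.
  case c0 : (code x 0%N) cx => cx.
    have -> : x = (golden R)^-1.
      apply: code_inj; rewrite ?invr_gt0 //; first exact: irrationalV.
      by rewrite codeV // cg; apply/funext => n; rewrite cx addbT.
    by apply: nobleV; rewrite ?gt_eqF.
  have -> // : x = golden R.
  by apply: code_inj => //; rewrite cg; apply/funext => n; rewrite cx addbF.
have nf : noble (farey x).
  apply: IH; [exact: farey_irrational|exact: farey_gt0|].
  by move=> n Nn; have := h n.+1 Nn; rewrite code_unfold.
have f0 := farey_gt0 _ irr x0.
case: (ltP x 1) => x1; last first.
  by move: nf; rewrite /farey ltNge x1 /= => /noble1D; rewrite addrC subrK.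
have [_ -> _] := farey_lt1 x ltac:(by rewrite x0).
apply: nobleV; first by rewrite lt0r_neq0 // addr_gt0 // invr_gt0.
by apply/noble1D/nobleV => //; rewrite lt0r_neq0.
Qed.

(** A generic number in the orbit of the golden section would make the golden
    section generic, by the inverse Moebius map. *)
Lemma generic_nonnoble x : generic x <-> nonnoble_irrational x.
Proof.
split=> [gx|[irr nn]].
  split; first by case: gx.
  case=> g e; have [ig g0 cg] := golden_code.
  have [y [_]] := generic_moebius g^-1%g _ gx.
  rewrite -e -moebiusM // mulVg moebius1 => nt [ye].
  by move: nt; rewrite -ye gtr0_norm // cg; apply; exists 0%N.
split=> // /alternating_noble h.
have {}h : noble `|x| by apply: h; [exact: irrational_norm|rewrite normr_gt0 irrational_neq0].
by apply: nn; move: h; case: (ger0P x) => // _ /nobleN; rewrite opprK.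
Qed.

End Action.

(** * Dyer's automorphism as a conjugation *)

Section Dyer.
Context {R : realType}.
Implicit Types (x y z : R) (g h : PGL2Z).

Lemma generic_irrational x : generic x -> irrational x.
Proof. by case. Qed.

(** A Moebius map fixing x, x + 1 and x + 2 is the identity: the quadratic
    polynomial of its fixed points has three roots. *)
Lemma moebius_faithful g x : generic x ->
  (forall z, generic z -> moebius g (Some z) = Some z) -> g = 1%g.
Proof.
move=> gx; have [M ->] := toPGL_surj g => fix_g.
have g1 z : generic z -> generic (1 + z).
  by move=> gz; rewrite -[z]opprK; apply/generic1B/genericN.
have eqn z : generic z ->
    (M 0 0)%:~R * z + (M 0 1)%:~R = z * ((M 1 0)%:~R * z + (M 1 1)%:~R) :> R.
  move=> gz; have irr := generic_irrational _ gz; have := fix_g z gz.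
  rewrite moebius_irrational // => -[/(canRL (divfK _))]; apply.
  exact/irrational_affine/GL2Z_row_neq0.
have e0 := eqn _ gx; have e1 := eqn _ (g1 _ gx); have e2 := eqn _ (g1 _ (g1 _ gx)).
have c0 : (M 1 0)%:~R = 0 :> R by lra.
have ad : (M 0 0)%:~R = (M 1 1)%:~R :> R by rewrite c0 in e0 e1; lra.
have b0 : (M 0 1)%:~R = 0 :> R by rewrite c0 ad in e0; lra.
move: c0 ad b0 => /eqP; rewrite intr_eq0 => /eqP c0 /intr_inj ad /eqP.
rewrite intr_eq0 => /eqP b0.
have dM := GL2Z_detP M; rewrite [X in det_pm1 X](mx22E M) in dM.
rewrite det_pm1_mx22 c0 b0 ad mulr0 subr0 abszM in dM.
have [d1|d1] : M 1 1 = 1 \/ M 1 1 = -1 by move: dM; rewrite muln_eq1; lia.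
  apply/toPGLP; rewrite /eq_pm.
  by rewrite [GL2Z_val M]mx22E c0 b0 ad d1 mx22_1 eqxx.
apply/toPGLP; rewrite /eq_pm [GL2Z_val M]mx22E c0 b0 ad d1.
by rewrite /= -mx22_1 mx22N oppr0 eqxx orbT.
Qed.

(** On generic numbers h is the conjugate of g by the involution [jimm]. *)
Definition jimm_conj g h := forall x, generic x ->
  moebius h (Some x) = jimm (moebius g (jimm (Some x))).

Lemma jimmK x : generic x -> jimm (jimm (Some x)) = Some x.
Proof. by move=> gx; rewrite !jimmE ?jimmRK //; apply: jimmR_generic. Qed.

Lemma jimm_conj1 : jimm_conj 1%g 1%g.
Proof. by move=> x gx; rewrite jimmE // !moebius1 -jimmE // jimmK. Qed.

Lemma jimm_conjM g h g' h' : jimm_conj g h -> jimm_conj g' h' ->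
  jimm_conj (g * g')%g (h * h')%g.
Proof.
move=> cj cj' x gx; have gj := jimmR_generic _ gx.
have [w gw e] := generic_moebius g' _ gj.
rewrite moebiusM; last exact: generic_irrational.
have e' : moebius h' (Some x) = Some (jimmR w) by rewrite cj' // jimmE // e jimmE.
rewrite e' cj; last exact: jimmR_generic.
rewrite -[Some (jimmR w)]jimmE // jimmK // (jimmE x) //.
by rewrite moebiusM ?e //; apply: generic_irrational.
Qed.

Lemma jimm_conj_sym g h : jimm_conj g h -> jimm_conj h g.
Proof.
move=> cj x gx; have gj := jimmR_generic _ gx.
by rewrite (jimmE x) // cj // -jimmE // jimmK //;
   have [w gw ->] := generic_moebius g _ gx; rewrite jimmK.
Qed.

Lemma jimm_conjU : jimm_conj PGL_U PGL_U.
Proof.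
move=> x gx; have gj := jimmR_generic _ gx.
rewrite jimmE // !moebiusU ?irrational_neq0 //; try exact: generic_irrational.
by rewrite jimmE ?jimmRV ?jimmRK //; apply: genericV.
Qed.

Lemma jimm_conjV : jimm_conj PGL_V (PGL_U * PGL_V)%g.
Proof.
move=> x gx; have gj := jimmR_generic _ gx.
rewrite jimmE // moebiusM ?moebiusV; last exact: generic_irrational.
rewrite moebiusU ?oppr_eq0 ?irrational_neq0 //; last exact: generic_irrational.
by rewrite jimmE ?jimmRN ?jimmRK ?invrN //; apply: genericN.
Qed.

Lemma jimm_conjK : jimm_conj PGL_K PGL_K.
Proof.
move=> x gx; have gj := jimmR_generic _ gx.
by rewrite jimmE // !moebiusK jimmE ?jimmR1B ?jimmRK //; apply: generic1B.
Qed.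

(** The string 00110011... is neither eventually constant nor eventually
    alternating. *)
Lemma generic_exists : exists x : R, generic x.
Proof.
pose a n := odd n./2.
have aE n m : (m < 4)%N -> a (4 * n + m)%N = (1 < m)%N.
  move=> m4; rewrite /a (_ : (4 * n + m)./2 = n.*2 + m./2)%N; last by lia.
  by rewrite oddD odd_double; case: m m4 => [|[|[|[|]]]].
(* The letters at 4 N + 1 and 4 N + 2 differ, those at 4 N and 4 N + 1 agree. *)
have nc : ~ tail_step false a.
  case=> N h; have := h (4 * N + 1)%N ltac:(lia).
  by rewrite -addnS !aE.
have nt : ~ tail_step true a.
  case=> N h; have := h (4 * N + 0)%N ltac:(lia).
  by rewrite -addnS !aE.
have [x [_ irr x0 cx]] := kappa_nonconst (R := R) _ nc.
by exists x; apply/generic_pos => //; rewrite cx.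
Qed.

(** This turns identities between permutations of the generic numbers into
    identities in the group. *)
Lemma jimm_conj_unique g h h' : jimm_conj g h -> jimm_conj g h' -> h = h'.
Proof.
move=> cj cj'; have [x gx] := generic_exists.
suff : (h^-1 * h')%g = 1%g by move/(canRL (mulKg _)); rewrite invgK mulg1.
apply: (moebius_faithful _ x) => // z gz; have irr := generic_irrational _ gz.
by rewrite moebiusM // cj' // -cj // -moebiusM // mulVg moebius1.
Qed.

Lemma jimm_conj_exists g : exists h, jimm_conj g h.
Proof.
elim/PGL2Z_ind: g => [|g [h cj]|g [h cj]|g [h cj]].
- by exists 1%g; apply: jimm_conj1.
- exists (PGL_U * h)%g; exact: jimm_conjM jimm_conjU cj.
- exists (PGL_U * PGL_V * h)%g; exact: jimm_conjM jimm_conjV cj.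
- exists (PGL_K * h)%g; exact: jimm_conjM jimm_conjK cj.
Qed.

(** The automorphism exists: conjugation by [jimm] is a choice of conjugates,
    multiplicative by uniqueness and its own inverse because [jimm] is an
    involution. *)
Lemma dyerP : is_dyer dyer.
Proof.
apply: (@xgetPex (PGL2Z -> PGL2Z : choiceType)).
have [f fP] := choice jimm_conj_exists; exists f.
have fE g h : jimm_conj g h -> f g = h by apply: jimm_conj_unique.
split.
- by exists f => g; apply: fE; apply: jimm_conj_sym.
- by move=> g h; apply/fE/jimm_conjM.
- by apply/fE/jimm_conjV.
- by apply/fE/jimm_conjU.
- by apply/fE/jimm_conjK.
Qed.

(** Only the values of [dyer] on the generators matter, whichever map
    satisfying [is_dyer] was chosen. *)
Lemma jimm_conj_dyer g : jimm_conj g (dyer g).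
Proof.
have [_ dM dV dU dK] := dyerP.
elim/PGL2Z_ind: g => [|g cj|g cj|g cj]; rewrite ?dM ?dV ?dU ?dK.
- have -> : dyer 1%g = 1%g by apply: (mulgI (dyer 1%g)); rewrite -dM !mulg1.
  exact: jimm_conj1.
- exact: jimm_conjM jimm_conjU cj.
- exact: jimm_conjM jimm_conjV cj.
- exact: jimm_conjM jimm_conjK cj.
Qed.

Lemma jimm_moebius g x : generic x ->
  jimm (moebius g (Some x)) = moebius (dyer g) (jimm (Some x)).
Proof.
move=> gx; rewrite [in RHS]jimmE // jimm_conj_dyer; last exact: jimmR_generic.
by rewrite -jimmE // jimmK.
Qed.

End Dyer.

Theorem mainTheorem1 (R : realType) :
  (forall x : R, nonnoble_irrational x ->
     exists2 y : R, nonnoble_irrational y & jimm (Some x) = Some y) /\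
  (forall x : R, nonnoble_irrational x ->
     jimm (jimm (Some x)) = Some x /\
     jimm (Some (1 / x)) = hat_inv (jimm (Some x)) /\
     jimm (Some (- x)) = hat_opp (hat_inv (jimm (Some x))) /\
     jimm (Some (1 - x)) = hat_add 1 (hat_opp (jimm (Some x))) /\
     jimm (Some (1 + x)) = hat_add 1 (hat_inv (jimm (Some x))) /\
     (forall M : PGL2Z,
        jimm (moebius M (jimm (Some x))) = moebius (dyer M) (Some x)) /\
     (forall M : PGL2Z,
        jimm (moebius M (Some x)) = moebius (dyer M) (jimm (Some x)))).
Proof.
split=> x /generic_nonnoble gx.
  by exists (jimmR x); rewrite ?jimmE //; apply/generic_nonnoble/jimmR_generic.
have gj := jimmR_generic _ gx.
have j0 : jimmR x != 0 by apply/irrational_neq0/generic_irrational.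
split; first exact: jimmK.
have jV : hat_inv (Some (jimmR x)) = Some (jimmR x)^-1 by rewrite /= (negbTE j0).
rewrite (jimmE x) // jV div1r.
split; first by rewrite jimmE ?jimmRV //; apply: genericV.
split; first by rewrite jimmE ?jimmRN //; apply: genericN.
split; first by rewrite jimmE ?jimmR1B //; apply: generic1B.
split.
  have gN := genericN _ gx.
  rewrite -{1}[x]opprK jimmE ?jimmR1B //; last exact: generic1B.
  by rewrite jimmRN //= opprK.
rewrite -(jimmE x) //; split=> M; last exact: jimm_moebius.
by rewrite jimm_conj_dyer.
Qed.
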